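(* Let $t \ge 2$ and let $G$ be a graph on $n$ vertices. For each $T \in \mathcal{K}_t(G)$ define \[ \alpha_G(T) = \max\{k : T \subseteq V(S) \text{ for some subgraph } S \subseteq G \text{ with } S \cong K_k\} \quad\text{and}\quad w_G(T) = \frac{\alpha_G(T)^t}{\binom{\alpha_G(T)}{t}}. \] Then $w_G(T)$ is well-defined and is a decreasing function of $\alpha_G(T)$, and \[ \sum_{T \in \mathcal{K}_t(G)} w_G(T) \le n^t, \] with equality if and only if $G$ is a balanced (complete) multipartite graph with at least $t$ parts.
   Context: For a graph $G$, $\mathcal{K}_t(G) = \{S \subseteq V(G) : G[S] \cong K_t\}$ is the set of vertex sets spanning a complete subgraph on $t$ vertices. A balanced multipartite graph is a complete multipartite graph whose parts all have the same size. *)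

(* Defs.v *)
From HB Require Import structures.
From mathcomp Require Import all_boot all_order all_algebra.
From mathcomp Require Import boolp.

Set Implicit Arguments.
Unset Strict Implicit.
Unset Printing Implicit Defensive.

Import Order.TTheory GRing.Theory Num.Theory.

Record sgraph (V : finType) := SGraph {
  adj :> rel V;
  adj_sym : symmetric adj;
  adj_irr : irreflexive adj
}.

Lemma complete_sym k : symmetric (fun i j : 'I_k => i != j).
Proof. by move=> i j; rewrite eq_sym. Qed.

Lemma complete_irr k : irreflexive (fun i j : 'I_k => i != j).
Proof. by move=> i; rewrite eqxx. Qed.

Definition complete_graph (k : nat) : sgraph 'I_k :=
  SGraph (@complete_sym k) (@complete_irr k).

Definition graph_iso (U W : finType) (G : sgraph U) (H : sgraph W) : Prop :=
  exists f : U -> W, bijective f /\ forall x y, H (f x) (f y) = G x y.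

Section Graph.
Variables (V : finType) (G : sgraph V).

Lemma induced_sym (S : {set V}) :
  symmetric (fun x y : {x : V | x \in S} => G (val x) (val y)).
Proof. by move=> x y; exact: adj_sym. Qed.

Lemma induced_irr (S : {set V}) :
  irreflexive (fun x y : {x : V | x \in S} => G (val x) (val y)).
Proof. by move=> x; exact: adj_irr. Qed.

Definition induced (S : {set V}) : sgraph {x : V | x \in S} :=
  SGraph (@induced_sym S) (@induced_irr S).

(* A graph H with vertex set W is a subgraph of G, not necessarily induced. *)
Definition is_subgraph (W : {set V}) (H : sgraph {x : V | x \in W}) : Prop :=
  forall x y, H x y -> G (val x) (val y).

Definition complete_sets (t : nat) : {set {set V}} :=
  [set S : {set V} | `[< graph_iso (induced S) (complete_graph t) >]].

Definition in_complete_subgraph (T : {set V}) (k : nat) : Prop :=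
  exists (W : {set V}) (H : sgraph {x : V | x \in W}),
    [/\ is_subgraph H, graph_iso H (complete_graph k) & T \subset W].

(* Restricting to k <= #|V| loses nothing, since a subgraph of G has at most
   #|V| vertices. *)
Definition alpha (T : {set V}) : nat :=
  \max_(k < #|V|.+1 | `[< in_complete_subgraph T k >]) k.

(* The r parts are the fibres of c. When V is nonempty, equal sizes force every
   part to be nonempty; on the empty vertex type all r parts are empty. *)
Definition balanced_multipartite (r : nat) : Prop :=
  exists c : V -> 'I_r,
    (forall x y, G x y = (c x != c y)) /\
    (forall i j, #|[set x | c x == i]| = #|[set x | c x == j]|).

End Graph.

Definition weight_of (t k : nat) : rat := (k%:R ^+ t / 'C(k, t)%:R)%R.

Definition weight (V : finType) (G : sgraph V) (t : nat) (T : {set V}) : rat :=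
  weight_of t (alpha G T).

(* Main.v *)
(* For weights w supported on cliques, f(x) = sum_T w(T) prod_(v in T) x_v is
   affine along any direction that shifts mass between two non-adjacent vertices.
   Hence for x >= 0 mass can be shifted, without decreasing f, until the support
   is a clique of some size k; there w <= k^t / C(k, t) and Maclaurin's inequality
   gives f(x) <= (sum x)^t. The constant x = 1 yields the bound.
   In the equality case x = 1 is an interior maximizer, so f is constant along all
   these shifts. This makes "no t-clique contains both u and v" a transitive
   relation, whose classes turn out to be the parts of a complete multipartite
   graph; the sum is then a multiple of an elementary symmetric polynomial of the
   part sizes, and strictness in Maclaurin's inequality forces equal sizes. *)
Require Import Defs.
From HB Require Import structures.
From mathcomp Require Import all_boot all_order all_algebra.
From mathcomp Require Import boolp.
From mathcomp Require Import ring lra zify.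

Set Implicit Arguments.
Unset Strict Implicit.
Unset Printing Implicit Defensive.

Import Order.TTheory GRing.Theory Num.Theory.

(** * Strict decrease of [k^t / 'C(k, t)] in [k] *)

(** Bernoulli's inequality [(1 - 1/(k+1))^t > 1 - t/(k+1)], multiplied by [(k+1)^t] to stay within
    the natural numbers. *)
Lemma bernoulli_strict k t : 2 <= t -> k.+1 ^ t < k ^ t + t * k.+1 ^ t.-1.
Proof.
case: t => [|[|t]] // _; elim: t => [|t IHt] /=.
  by rewrite !expnS !expn0 /=; lia.
move: IHt; rewrite /= => IHt.
have le_k : k ^ t.+2 <= k.+1 ^ t.+2 by rewrite leq_exp2r.
have E1 : k.+1 ^ t.+3 = k.+1 * k.+1 ^ t.+2 by rewrite expnS.
have E2 : k.+1 ^ t.+2 = k.+1 * k.+1 ^ t.+1 by rewrite expnS.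
have E3 : k ^ t.+3 = k * k ^ t.+2 by rewrite expnS.
(* Scaling the induction hypothesis by [k+1] leaves a surplus [k^(t+2)], which [le_k] absorbs into
   one more copy of [(k+1)^(t+2)]. *)
have : k.+1 * k.+1 ^ t.+2 < k.+1 * (k ^ t.+2 + t.+2 * k.+1 ^ t.+1).
  by rewrite ltn_pmul2l.
rewrite mulnDr [k.+1 * (_ * _)]mulnCA -E2 E1 E3; lia.
Qed.

Lemma ex_subset_card (V : finType) (S : {set V}) m :
  m <= #|S| -> exists2 T : {set V}, T \subset S & #|T| = m.
Proof.
move=> le_m; have : 0 < #|[set A : {set V} | A \subset S & #|A| == m]|.
  by rewrite cards_draws bin_gt0.
by case/card_gt0P=> T; rewrite inE => /andP[sTS /eqP cT]; exists T.
Qed.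

Local Open Scope ring_scope.

(** Since [(k+1) 'C(k, t) = (k+1-t) 'C(k+1, t)], the binomials cancel after cross-multiplication and
    leave [(k+1)^(t-1) (k+1-t) < k^t], which is Bernoulli's inequality. *)
Lemma weight_of_ltS t k : (2 <= t)%N -> (t <= k)%N ->
  weight_of t k.+1 < weight_of t k.
Proof.
move=> t2 tk; rewrite /weight_of.
have C0 : (0 < 'C(k, t))%N by rewrite bin_gt0.
have C1 : (0 < 'C(k.+1, t))%N by rewrite bin_gt0 ltnW.
rewrite ltr_pdivrMr ?ltr0n // mulrAC ltr_pdivlMr ?ltr0n //.
rewrite -!natrX -!natrM ltr_nat.
have E : (k.+1 * 'C(k, t) = (k.+1 - t) * 'C(k.+1, t))%N.
  by rewrite mul_bin_down.
have B := bernoulli_strict k t2.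
rewrite -(@ltn_pmul2l k.+1) // mulnCA E mulnA [in ltnRHS]mulnA ltn_pmul2r //.
have -> : (k.+1 ^ t = k.+1 * k.+1 ^ t.-1)%N by rewrite -expnS prednK // ltnW.
rewrite -mulnA ltn_pmul2l //.
move: B; have -> : (k.+1 ^ t = k.+1 * k.+1 ^ t.-1)%N.
  by rewrite -expnS prednK // ltnW.
by rewrite mulnBr; lia.
Qed.

Lemma weight_of_lt t k l : (2 <= t)%N -> (t <= k)%N -> (k < l)%N ->
  weight_of t l < weight_of t k.
Proof.
move=> t2 tk; elim: l => // l IHl; rewrite ltnS leq_eqVlt => /predU1P[<-|kl].
  exact: weight_of_ltS.
apply: lt_trans (IHl kl); apply: weight_of_ltS => //.
exact: leq_trans tk (ltnW kl).
Qed.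

(** * Multilinear forms and their dependence on two variables *)

Section MultilinearForm.
Variables (R : realFieldType) (V : finType).
Implicit Types (w : {set V} -> R) (x y : V -> R) (u v : V) (S T : {set V}).

Definition mform w x : R := \sum_(T : {set V}) w T * \prod_(z in T) x z.

(** Coefficients after the substitution [x u = 0]. *)
Definition del u w T : R := if u \in T then 0 else w T.

(** Coefficients of the partial derivative in [x u]. *)
Definition der u w T : R := if u \in T then 0 else w (u |: T).

Definition upd2 x u v (a b : R) z : R :=
  if z == u then a else if z == v then b else x z.

Lemma eq_mform w w' x y :
  (forall T, w T = w' T) ->
  (forall T z, w T != 0 -> z \in T -> x z = y z) -> mform w x = mform w' y.
Proof.
move=> eqw eqx; apply: eq_bigr => T _; rewrite -eqw.
have [->|wT] := eqVneq (w T) 0; first by rewrite !mul0r.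
by congr (_ * _); apply: eq_bigr => z zT; apply: eqx zT.
Qed.

Lemma mform0 w x : (forall T, w T = 0) -> mform w x = 0.
Proof. by move=> w0; apply: big1 => T _; rewrite w0 mul0r. Qed.

Lemma mform_ge0 w x : (forall T, 0 <= w T) -> (forall z, 0 <= x z) ->
  0 <= mform w x.
Proof.
by move=> w0 x0; apply: sumr_ge0 => T _; apply: mulr_ge0 => //; apply: prodr_ge0.
Qed.

Lemma mform_split w x u :
  mform w x = mform (del u w) x + x u * mform (der u w) x.
Proof.
rewrite /mform (bigID (fun T : {set V} => u \in T)) /= addrC; congr (_ + _).
  rewrite [RHS](bigID (fun T : {set V} => u \in T)) /= [X in _ = X + _]big1.
    by rewrite add0r; apply: eq_bigr => T /negPf uT; rewrite /del uT.
  by move=> T uT; rewrite /del uT mul0r.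
(* Removing [u] matches the monomials divisible by [x u] with those of the derivative. *)
rewrite (reindex_onto (fun T => u |: T) (fun T => T :\ u)) /=; last first.
  by move=> T uT; rewrite setD1K.
rewrite mulr_sumr [RHS](bigID (fun T : {set V} => u \in T)) /= [X in _ = X + _]big1.
  rewrite add0r; apply: eq_big => T.
    rewrite setU11 /=; apply/eqP/idP => [<-|uT]; first by rewrite !inE eqxx.
    by rewrite setU1K.
  case/andP=> _ /eqP eqT; have uT : u \notin T by rewrite -eqT !inE eqxx.
  by rewrite /der (negPf uT) big_setU1 //= mulrCA.
by move=> T uT; rewrite /der uT mul0r mulr0.
Qed.

Lemma mform_upd2 w x u v a b :
  (forall T, (u \in T) || (v \in T) -> w T = 0) ->
  mform w (upd2 x u v a b) = mform w x.
Proof.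
move=> w0; apply: eq_mform => // T z wT zT; rewrite /upd2.
by do 2![case: eqP => [E|_]; first by rewrite w0 ?eqxx // -E zT ?orbT in wT].
Qed.

Lemma upd2_id x u v z : upd2 x u v (x u) (x v) z = x z.
Proof. by rewrite /upd2; do 2![case: eqP => [->|_] //]. Qed.

(** Splitting at [u] and then at [v] leaves four forms that involve neither variable. When the mixed
    coefficient vanishes, the value is affine along [a + b = const]. *)
Lemma mform_pair w x u v a b : u != v ->
  mform w (upd2 x u v a b) =
  mform (del v (del u w)) x + a * mform (del v (der u w)) x
  + b * mform (der v (del u w)) x + a * b * mform (der v (der u w)) x.
Proof.
move=> uv; have vu : v == u = false by rewrite eq_sym (negPf uv).
set y := upd2 _ _ _ _ _.
have yu : y u = a by rewrite /y /upd2 eqxx.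
have yv : y v = b by rewrite /y /upd2 eq_sym (negPf uv) eqxx.
rewrite (mform_split w y u) (mform_split (del u w) y v) (mform_split (der u w) y v).
rewrite yu yv.
have E w' : (forall T, (u \in T) || (v \in T) -> w' T = 0) -> mform w' y = mform w' x.
  exact: mform_upd2.
rewrite !E; first by ring.
all: move=> T; rewrite /del /der ?in_setU1 ?(negPf uv) ?vu /=.
all: by case: (u \in T); case: (v \in T).
Qed.

Lemma del_der w u v T : u != v -> del u (der v w) T = der v (del u w) T.
Proof.
by move=> uv; rewrite /del /der in_setU1 (negPf uv) /=; do 2!case: ifP.
Qed.

Lemma sum_upd2 (P : pred V) x u v a b : u != v -> P u -> P v ->
  \sum_(z | P z) upd2 x u v a b z = a + b + (\sum_(z | P z) x z - x u - x v).
Proof.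
move=> uv Pu Pv; have Pvu : P v && (v != u) by rewrite Pv eq_sym.
rewrite (bigD1 u) // (bigD1 v) //= (bigD1 u Pu) (bigD1 v Pvu) /=.
rewrite /upd2 eqxx eq_sym (negPf uv) eqxx.
rewrite (eq_bigr x) => [|z /andP[/andP[_ /negPf->] /negPf->] //].
by ring.
Qed.

Lemma upd2_ge0 x u v a b : (forall z, 0 <= x z) -> 0 <= a -> 0 <= b ->
  forall z, 0 <= upd2 x u v a b z.
Proof. by move=> x0 a0 b0 z; rewrite /upd2; do 2?case: ifP. Qed.

(** * Elementary symmetric polynomials and Maclaurin's inequality *)

Definition elem_sym S t x : R :=
  \sum_(T : {set V} | (T \subset S) && (#|T| == t)) \prod_(z in T) x z.

Lemma elem_symE S t x :
  elem_sym S t x = mform (fun T => ((T \subset S) && (#|T| == t))%:R) x.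
Proof.
rewrite /elem_sym big_mkcond; apply: eq_bigr => T _.
by case: ifP; rewrite ?mul1r ?mul0r.
Qed.

Lemma elem_sym_const S t (m : R) x : (forall z, z \in S -> x z = m) ->
  elem_sym S t x = 'C(#|S|, t)%:R * m ^+ t.
Proof.
move=> xm; rewrite /elem_sym (eq_bigr (fun _ => m ^+ t)) => [|T /andP[sTS /eqP<-]].
  rewrite sumr_const -cards_draws mulr_natl.
  by congr (_ *+ _); apply: eq_card => T; rewrite !inE.
by rewrite -prodr_const; apply: eq_bigr => z zT; rewrite xm ?(subsetP sTS).
Qed.

(** By symmetry in [i] and [j], only [a + b] and [a * b] enter. The coefficient [C] of [a * b] is
    the elementary symmetric polynomial of degree [t - 2] in the other variables of [S] (zero if
    [t < 2]). *)
Lemma elem_sym_smooth S t x i j : i \in S -> j \in S -> i != j ->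
  (forall z, 0 <= x z) ->
  exists2 C : R, 0 <= C /\
      ((2 <= t <= #|S|)%N -> (forall z, z \in S -> 0 < x z) -> 0 < C) &
    forall a b, a + b = x i + x j ->
    elem_sym S t (upd2 x i j a b) = elem_sym S t x + C * (a * b - x i * x j).
Proof.
move=> iS jS ij x0; pose w T : R := ((T \subset S) && (#|T| == t))%:R.
have der0 T : 0 <= der j (der i w) T by rewrite /der; do 2?case: ifP.
exists (mform (der j (der i w)) x); first split; first exact: mform_ge0.
  move=> /andP[t2 tS] xS.
  (* One positive monomial suffices for [0 < C], the other terms being nonnegative. *)
  have [|T sT cT] := @ex_subset_card _ (S :\ i :\ j) (t - 2).
    have := cardsD1 i S; have := cardsD1 j (S :\ i); rewrite iS !inE eq_sym ij jS /=.
    by lia.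
  have iT : i \notin T by apply/negP => /(subsetP sT); rewrite !inE eqxx andbF.
  have jT : j \notin T by apply/negP => /(subsetP sT); rewrite !inE eqxx.
  have TS : T \subset S.
    by apply: subset_trans sT _; apply/subsetP=> z; rewrite !inE => /and3P[].
  rewrite /mform (bigD1 T) //=; apply: ltr_pwDl; last first.
    by apply: sumr_ge0 => T' _; rewrite mulr_ge0 ?prodr_ge0.
  rewrite mulr_gt0 ?prodr_gt0 // => [|z zT]; last by rewrite xS // (subsetP TS).
  rewrite /der (negPf jT) in_setU1 (negPf ij) (negPf iT) /= /w.
  rewrite !subUset !sub1set iS jS TS /= !cardsU1 in_setU1 (negPf ij) (negPf iT).
  by rewrite jT /=; have -> : (1 + (1 + #|T|) == t)%N by lia.
move=> a b ab; rewrite !elem_symE -/w.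
rewrite -(@eq_mform w w (upd2 x i j (x i) (x j)) x) => // [|T z _ _]; last first.
  exact: upd2_id.
rewrite !mform_pair //.
have -> : mform (der j (del i w)) x = mform (del j (der i w)) x.
  apply: eq_mform => // T; rewrite /del /der !in_setU1 (negPf ij) /=.
  case: (boolP (i \in T)) => iT; case: (boolP (j \in T)) => jT //=.
  by rewrite /w !subUset !sub1set iS jS !cardsU1 iT jT.
have -> : b = x i + x j - a by rewrite -ab; ring.
by ring.
Qed.

(** The deviations from the mean sum to zero, so a nonzero one forces deviations of both signs.
    Scaling by [#|S|] avoids division. *)
Lemma exists_off_mean S x i : i \in S -> x i * #|S|%:R != \sum_(z in S) x z ->
  exists i j, [/\ i \in S, j \in S, x i * #|S|%:R < \sum_(z in S) x z
                 & \sum_(z in S) x z < x j * #|S|%:R].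
Proof.
set N := \sum_(z in S) x z => iS xi.
have sum0 : \sum_(z in S) (x z * #|S|%:R - N) = 0.
  by rewrite sumrB -mulr_suml -/N sumr_const mulr_natr subrr.
have [/exists_inP[p pS lep]|] := boolP [exists p in S, x p * #|S|%:R < N].
  have [/exists_inP[q qS leq]|] := boolP [exists q in S, N < x q * #|S|%:R].
    by exists p, q.
  move/exists_inPn => le0; suff : \sum_(z in S) (x z * #|S|%:R - N) < 0.
    by rewrite sum0 ltxx.
  rewrite (bigD1 p) //=; apply: ltr_nwDl; first by rewrite subr_lt0.
  by apply: sumr_le0 => z /andP[zS _]; rewrite subr_le0 leNgt le0.
move/exists_inPn => ge0; have /eqP := sum0.
rewrite psumr_eq0 => [/allP/(_ i (mem_index_enum _))|z zS].
  by rewrite iS subr_eq0 (negPf xi).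
by rewrite subr_ge0 leNgt ge0.
Qed.

(** Of two entries on opposite sides of the mean, one is moved exactly to the mean and the other
    compensates. The set of entries off the mean shrinks, which makes the step usable in an
    induction. *)
Lemma smoothing_step S t x i : (forall z, 0 <= x z) -> i \in S ->
  x i * #|S|%:R != \sum_(z in S) x z ->
  exists y : V -> R, [/\ forall z, 0 <= y z, \sum_(z in S) y z = \sum_(z in S) x z,
    [set z in S | y z * #|S|%:R != \sum_(z in S) x z] \proper
    [set z in S | x z * #|S|%:R != \sum_(z in S) x z],
    elem_sym S t x <= elem_sym S t y &
    (2 <= t <= #|S|)%N -> (forall z, z \in S -> 0 < x z) -> elem_sym S t x < elem_sym S t y].
Proof.
move=> x0 iS xi; have [p [q [pS qS xp xq]]] := exists_off_mean iS xi.
set N := \sum_(z in S) x z in xi xp xq *; set k : R := #|S|%:R in xi xp xq *.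
have k0 : 0 < k by rewrite ltr0n; apply/card_gt0P; exists i.
have pq : p != q by apply/eqP => E; have := lt_trans xp xq; rewrite E ltxx.
have N0 : 0 <= N by apply: sumr_ge0.
have lep : x p < N / k by rewrite ltr_pdivlMr.
have leq : N / k < x q by rewrite ltr_pdivrMr.
have [C [C0 C1] eC] := elem_sym_smooth t pS qS pq x0.
pose b := x p + x q - N / k.
have b0 : 0 <= b by rewrite /b; have := x0 p; lra.
(* With the sum fixed, the product of the two entries grows by [(N/k - x p) (x q - N/k)]. *)
have gain : 0 < N / k * b - x p * x q.
  have -> : N / k * b - x p * x q = (N / k - x p) * (x q - N / k) by rewrite /b; ring.
  by rewrite mulr_gt0 ?subr_gt0.
have {}eC := eC (N / k) b ltac:(by rewrite /b; ring).
exists (upd2 x p q (N / k) b); split.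
- by apply: upd2_ge0 => //; rewrite divr_ge0 // ltW.
- by rewrite (sum_upd2 _ _ _ pq pS qS) /b -/N; ring.
- apply/properP; split.
    apply/subsetP=> z; rewrite !inE /upd2 => /andP[-> /=].
    case: (z =P p) => [_|_]; first by rewrite divfK ?eqxx // gt_eqF.
    by case: (z =P q) => [-> _|//]; rewrite gt_eqF.
  exists p; first by rewrite inE pS /= lt_eqF.
  by rewrite inE pS /upd2 eqxx divfK ?eqxx // gt_eqF.
- by rewrite eC lerDl mulr_ge0 // ltW.
by move=> tS xS; rewrite eC ltrDl mulr_gt0 // C1.
Qed.

(** Induction on the number of entries off the mean; when there are none, both sides agree. *)
Lemma maclaurin S t x : (forall z, 0 <= x z) ->
  elem_sym S t x * #|S|%:R ^+ t <= 'C(#|S|, t)%:R * (\sum_(z in S) x z) ^+ t.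
Proof.
have [m] := ubnP #|[set z in S | x z * #|S|%:R != \sum_(z in S) x z]|.
elim: m x => // m IHm x lem x0.
have [/exists_inP[i iS xi]|] :=
    boolP [exists i in S, x i * #|S|%:R != \sum_(z in S) x z].
  have [y [y0 sy lty ley _]] := smoothing_step t x0 iS xi.
  rewrite -sy; apply: le_trans (IHm y _ y0).
    by apply: ler_wpM2r => //; rewrite exprn_ge0.
  by rewrite sy; apply: leq_trans (proper_card lty) _.
move/exists_inPn => /= all_mean.
(* An empty [S] has no mean; both sides then equal ['C(0, t) 0^t]. *)
have [k0|k0] := posnP #|S|.
  have -> : S = set0 by apply/eqP; rewrite -cards_eq0 k0.
  rewrite big_set0 cards0 (@elem_sym_const _ _ 0) ?cards0 => [|z]; last by rewrite inE.
  by rewrite -mulrA -exprMn mulr0.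
rewrite (@elem_sym_const S t ((\sum_(z in S) x z) / #|S|%:R)) => [|z zS].
  by rewrite -mulrA -exprMn divfK // pnatr_eq0 -lt0n.
have /negPn/eqP <- := all_mean z zS.
by rewrite mulfK // pnatr_eq0 -lt0n.
Qed.

(** A single smoothing step gains strictly, and the weak inequality applies to its result. *)
Lemma maclaurin_lt S t x i : (forall z, 0 <= x z) -> (2 <= t <= #|S|)%N ->
  (forall z, z \in S -> 0 < x z) -> i \in S ->
  x i * #|S|%:R != \sum_(z in S) x z ->
  elem_sym S t x * #|S|%:R ^+ t < 'C(#|S|, t)%:R * (\sum_(z in S) x z) ^+ t.
Proof.
move=> x0 tS xS iS xi; have [y [y0 sy _ _ /(_ tS xS) lty]] := smoothing_step t x0 iS xi.
rewrite -sy; apply: lt_le_trans (maclaurin S t y0).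
rewrite ltr_pM2r // exprn_gt0 // ltr0n.
by case/andP: tS => t2; apply: leq_trans; apply: ltnW.
Qed.

(** * Upper bound for forms supported on cliques, and their maximizers *)

(** Induction on the size of the support of [x]: a non-adjacent pair in it allows one of the two
    vertices to be emptied into the other. *)
Lemma mform_le w (e : rel V) t x :
  (forall T u v, u \in T -> v \in T -> u != v -> ~~ e u v -> w T = 0) ->
  (forall S T, {in S &, forall u v, u != v -> e u v} -> T \subset S ->
     w T * 'C(#|S|, t)%:R <= #|S|%:R ^+ t) ->
  (forall T, #|T| != t -> w T = 0) ->
  (forall z, 0 <= x z) -> mform w x <= (\sum_z x z) ^+ t.
Proof.
move=> w_e w_le w_t.
have [m] := ubnP #|[set z | x z != 0]|.
elim: m x => // m IHm x lem x0; set S := [set z | x z != 0] in lem.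
have N0 : 0 <= \sum_z x z by apply: sumr_ge0.
have [/existsP[u /existsP[v /and4P[uS vS uv euv]]]|] :=
  boolP [exists u, exists v, [&& u \in S, v \in S, u != v & ~~ e u v]].
  have {euv} : forall T, u \in T -> v \in T -> w T = 0.
    by move=> T uT vT; apply: w_e uT vT uv euv.
  (* The vertex with the larger partial derivative is called [u] and receives the mass of [v]. *)
  wlog le_uv : u v uS vS uv /
      mform (der v (del u w)) x <= mform (del v (der u w)) x.
    move=> WL nuv; have vu : v != u by rewrite eq_sym.
    have [|/ltW] := lerP (mform (der v (del u w)) x) (mform (del v (der u w)) x).
      by move/WL; apply.
    rewrite -(eq_mform (fun T => del_der w T uv) (fun _ _ _ _ => erefl)).
    rewrite (eq_mform (fun T => del_der w T vu) (fun _ _ _ _ => erefl)).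
    by move/(WL v u vS uS vu); apply => T vT uT; apply: nuv.
  move=> nuv; pose y := upd2 x u v (x u + x v) 0.
  have y0 z : 0 <= y z by apply: upd2_ge0; rewrite ?addr_ge0.
  have sy : \sum_z y z = \sum_z x z by rewrite (@sum_upd2 xpredT) //; ring.
  have le_xy : mform w x <= mform w y.
    rewrite -(@eq_mform w w (upd2 x u v (x u) (x v)) x) // => [|T z _ _]; last first.
      exact: upd2_id.
    rewrite !mform_pair // [mform (der v (der u w)) x]mform0 => [|T].
      by rewrite !mulr0 mul0r !addr0 mulrDl addrA lerD2l ler_wpM2l.
    by rewrite /der; do 2?case: ifP => // _; rewrite nuv // !inE eqxx ?orbT.
  apply: le_trans le_xy _; rewrite -sy; apply: IHm => //.
  rewrite -ltnS; apply: leq_trans lem; rewrite ltnS; apply/proper_card/properP; split.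
    apply/subsetP=> z; rewrite !inE /y /upd2.
    case: (z =P u) => [-> _|_]; first by rewrite inE in uS.
    by case: (z =P v) => [_|//]; rewrite eqxx.
  by exists v => //; rewrite inE /y /upd2 [v == u]eq_sym (negPf uv) !eqxx.
move/existsPn => all_e.
have clS : {in S &, forall u v, u != v -> e u v}.
  move=> u v uS vS uv; move/existsPn/(_ v): (all_e u).
  by rewrite uS vS uv /= negbK.
have term0 T : ~~ ((T \subset S) && (#|T| == t)) -> w T * \prod_(z in T) x z = 0.
  rewrite negb_and => /orP[/subsetPn[z zT]|/w_t->]; last by rewrite mul0r.
  by rewrite inE negbK => /eqP xz; rewrite (bigD1 z) //= xz mul0r mulr0.
(* A support of fewer than [t] vertices kills every term; otherwise ['C(#|S|, t)] is positive and
   can be multiplied through. *)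
have [tS|St] := leqP t #|S|; last first.
  rewrite /mform big1 ?exprn_ge0 // => T _; apply: term0; apply/negP => /andP[sTS /eqP cT].
  by have := subset_leq_card sTS; lia.
have C0 : 0 < 'C(#|S|, t)%:R :> R by rewrite ltr0n bin_gt0.
rewrite -(ler_pM2l C0).
have -> : \sum_z x z = \sum_(z in S) x z.
  by rewrite big_mkcond [RHS]big_mkcond; apply: eq_bigr => z _; rewrite inE; case: eqP.
apply: le_trans (maclaurin S t x0).
rewrite /mform (bigID (fun T => (T \subset S) && (#|T| == t))) /=.
rewrite [X in _ + X]big1 ?addr0 /elem_sym; last by move=> T /term0.
rewrite mulr_sumr mulr_suml; apply: ler_sum => T /andP[sTS _].
by rewrite mulrA mulrC ler_wpM2l ?prodr_ge0 // mulrC w_le.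
Qed.

(** The form is affine along [a + b = const], and an affine function with a maximum inside a segment
    is constant. *)
Lemma maximizer_der_eq w t x u v :
  (forall y, (forall z, 0 <= y z) -> mform w y <= (\sum_z y z) ^+ t) ->
  (forall z, 0 <= x z) -> 0 < x u -> 0 < x v -> u != v ->
  (forall T, u \in T -> v \in T -> w T = 0) ->
  mform w x = (\sum_z x z) ^+ t ->
  mform (der u w) x = mform (der v w) x /\
  forall a b, a + b = x u + x v -> mform w (upd2 x u v a b) = mform w x.
Proof.
move=> w_le x0 xu xv uv nuv max_x; have vu : v != u by rewrite eq_sym.
have dd T : der v (der u w) T = 0.
  by rewrite /der; do 2?case: ifP => // _; rewrite nuv // !inE eqxx ?orbT.
have dd' T : der u (der v w) T = 0.
  by rewrite /der; do 2?case: ifP => // _; rewrite nuv // !inE eqxx ?orbT.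
have Eu : mform (del v (der u w)) x = mform (der u w) x.
  by rewrite [RHS](mform_split _ _ v) (mform0 _ dd) mulr0 addr0.
have Ev : mform (der v (del u w)) x = mform (der v w) x.
  rewrite [RHS](mform_split _ _ u) (mform0 _ dd') mulr0 addr0.
  by apply: eq_mform => // T; rewrite del_der.
have E a b : mform w (upd2 x u v a b) =
    mform (del v (del u w)) x + a * mform (der u w) x + b * mform (der v w) x.
  by rewrite mform_pair // Eu Ev (mform0 _ dd) mulr0 addr0.
have Ex : mform w x =
    mform (del v (del u w)) x + x u * mform (der u w) x + x v * mform (der v w) x.
  by rewrite -E; apply: eq_mform => // T z _ _; rewrite upd2_id.
have le a b : 0 <= a -> 0 <= b -> a + b = x u + x v ->
    mform w (upd2 x u v a b) <= mform w x.
  move=> a0 b0 ab; rewrite max_x.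
  have <- : \sum_z upd2 x u v a b z = \sum_z x z.
    by rewrite (@sum_upd2 xpredT) // ab; ring.
  by apply: w_le; apply: upd2_ge0.
have D : mform (der u w) x = mform (der v w) x.
  (* The two ends of the segment give the two inequalities between the derivatives. *)
  have := le (x u + x v) 0; have := le 0 (x u + x v).
  rewrite !E Ex addr0 add0r => le1 le2.
  have {}le1 := le1 (lexx _) (addr_ge0 (x0 _) (x0 _)) erefl.
  have {}le2 := le2 (addr_ge0 (x0 _) (x0 _)) (lexx _) erefl.
  by apply/eqP; rewrite eq_le -(ler_pM2l xv) -[X in _ && X](ler_pM2l xu); lra.
by split=> // a b ab; rewrite E Ex D -!addrA -!mulrDl ab.
Qed.

(* At a maximizer all partial derivatives along zero-coefficient pairs agree;
   moving mass from z to u changes the v-derivative at rate [der u (der v w)]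
   but leaves the z-derivative fixed. *)
Lemma maximizer_trans w t x u z v :
  (forall y, (forall z, 0 <= y z) -> mform w y <= (\sum_z y z) ^+ t) ->
  (forall T, 0 <= w T) -> (forall s, 0 < x s) ->
  mform w x = (\sum_z x z) ^+ t ->
  u != z -> z != v -> u != v ->
  (forall T, u \in T -> z \in T -> w T = 0) ->
  (forall T, z \in T -> v \in T -> w T = 0) ->
  forall T, u \in T -> v \in T -> w T = 0.
Proof.
move=> w_le w0 x0 max_x uz zv uv nuz nzv.
have x0' s : 0 <= x s by rewrite ltW.
have vz : v != z by rewrite eq_sym.
have nvz T : v \in T -> z \in T -> w T = 0 by move=> vT zT; apply: nzv.
have [_ shift] := maximizer_der_eq w_le x0' (x0 u) (x0 z) uz nuz max_x.
(* Moving only half of the mass of [z] keeps every value positive, so [y] is again an interior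
   maximizer. *)
pose y := upd2 x u z (x u + x z / 2) (x z / 2).
have xz2 : 0 < x z / 2 by rewrite divr_gt0.
have ab : x u + x z / 2 + x z / 2 = x u + x z by field.
have y_gt0 s : 0 < y s by rewrite /y /upd2; do 2?case: ifP => // _; rewrite addr_gt0.
have sy : \sum_s y s = \sum_s x s by rewrite (@sum_upd2 xpredT) // ab; ring.
have max_y : mform w y = (\sum_s y s) ^+ t by rewrite shift // sy.
have [Dx _] := maximizer_der_eq w_le x0' (x0 v) (x0 z) vz nvz max_x.
have [Dy _] := maximizer_der_eq w_le (fun s => ltW (y_gt0 s)) (y_gt0 v) (y_gt0 z) vz nvz max_y.
have Dz : mform (der z w) y = mform (der z w) x.
  apply: mform_upd2 => T; rewrite /der; case: ifP => // zT; rewrite orbF => uT.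
  by rewrite nuz // !inE ?uT ?eqxx ?orbT.
have E w' : (forall T, (u \in T) || (z \in T) -> w' T = 0) -> mform w' y = mform w' x.
  exact: mform_upd2.
(* The [v]-derivatives at [y] and [x] agree, and they differ by [x z / 2] times this form. *)
have : mform (der u (der v w)) x = 0.
  move: Dy; rewrite Dz -Dx (mform_split _ y u) (mform_split _ x u).
  have -> : y u = x u + x z / 2 by rewrite /y /upd2 eqxx.
  rewrite !E; last 2 first.
  - move=> T; rewrite /del /der; case: (u \in T) => //= zT; case: ifP => // _.
    by rewrite nvz // !inE ?zT ?eqxx ?orbT.
  - move=> T; rewrite /del /der; case: (u \in T) => //= zT; case: ifP => // _.
    by rewrite nvz // !inE ?zT ?eqxx ?orbT.
  move/addrI/eqP; rewrite mulrDl -subr_eq0 addrAC subrr add0r mulf_eq0 gt_eqF //=.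
  by move/eqP.
(* A form with nonnegative coefficients that vanishes at a positive point has only zero
   coefficients; the one at [T] minus [u] and [v] is [w T]. *)
move/eqP; rewrite /mform psumr_eq0 => [/allP dd|T _]; last first.
  by rewrite mulr_ge0 ?prodr_ge0 // /der; do 2?case: ifP.
move=> T uT vT; have := dd (T :\ v :\ u) (mem_index_enum _); rewrite /der in_setD1 eqxx /=.
rewrite setD1K ?in_setD1 ?uv // eqxx /= setD1K // mulf_eq0.
by rewrite [X in _ || X]gt_eqF ?prodr_gt0 // orbF => /eqP.
Qed.
End MultilinearForm.

(** * Transversals of a partition *)

(** Expanding a product of fibre sums over [A] chooses one vertex in each fibre, that is, a set on
    which [c] is injective with image [A]. *)
Lemma elem_sym_fibers (R : realFieldType) (V I : finType) (v0 : V) (c : V -> I) t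
    (x : V -> R) :
  \sum_(T : {set V} | (#|T| == t) && (#|c @: T| == #|T|)) \prod_(z in T) x z =
  elem_sym [set: I] t (fun i => \sum_(v | c v == i) x v).
Proof.
rewrite /elem_sym (partition_big (fun T : {set V} => c @: T)
  (fun A => (A \subset [set: I]) && (#|A| == t))) /=; last first.
  by move=> T /andP[/eqP<- /eqP->]; rewrite subsetT eqxx.
apply: eq_bigr => A /andP[_ /eqP cA].
rewrite (big_distr_big_dep v0) /=.
(* [tr] recovers the choice function from its image; the default [v0] outside [A] is the
   normalisation that the distributivity law demands. *)
pose tr (T : {set V}) := [ffun i => if i \in A then odflt v0 [pick v in T | c v == i] else v0].
have trP (T : {set V}) i : c @: T = A -> i \in A -> tr T i \in T /\ c (tr T i) = i.
  move=> cT iA; rewrite /tr ffunE iA; case: pickP => [v /andP[vT /eqP]|] //=.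
  have /imsetP[v vT ->] : i \in c @: T by rewrite cT.
  by move/(_ v); rewrite vT eqxx.
rewrite (reindex_onto (fun f : {ffun I -> V} => f @: A) tr) /=; last first.
  move=> T /andP[/andP[_ /imset_injP c_inj] /eqP cT]; apply/setP=> v.
  apply/imsetP/idP => [[i iA ->]|vT]; first by have [] := trP T i cT iA.
  have cvA : c v \in A by rewrite -cT imset_f.
  by exists (c v) => //; have [trT ctr] := trP T _ cT cvA; apply: c_inj.
apply: eq_big => f.
  apply/idP/pfamilyP => [/andP[/andP[_ /eqP cfA] /eqP <-]|[fA cf]].
    split=> [|i iA]; last by apply/eqP; case: (trP _ i cfA iA).
    by apply/subsetP=> i; rewrite inE ffunE; case: ifP; rewrite ?eqxx.
  have {}cf i : i \in A -> c (f i) = i by move/cf/eqP.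
  have cfA : c @: (f @: A) = A.
    apply/setP=> i; apply/imsetP/idP => [[_ /imsetP[j jA ->] ->]|iA]; first by rewrite cf.
    by exists (f i); rewrite ?imset_f // cf.
  have f_inj : {in A &, injective f} by move=> i j iA jA /(congr1 c); rewrite !cf.
  rewrite cfA card_in_imset // cA !eqxx /=; apply/eqP/ffunP => i.
  have [iA|iA] := boolP (i \in A).
    have [/imsetP[j jA E]] := trP _ i cfA iA.
    by rewrite E cf // => <-.
  rewrite ffunE (negPf iA); apply/eqP; apply: contraNT iA => fi.
  by apply: (subsetP fA); rewrite inE eq_sym.
case/andP=> /andP[_ /eqP cfA] /eqP <-; rewrite big_imset //.
move=> i j iA jA /(congr1 c).
by have [_ ->] := trP _ i cfA iA; have [_ ->] := trP _ j cfA jA.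
Qed.

(** * Cliques and the clique number through a given set *)

Section GraphFacts.
Variables (V : finType) (G : sgraph V).
Implicit Types (S T W : {set V}) (t k : nat).

Definition clique S := [forall x in S, forall y in S, (x != y) ==> G x y].

Lemma cliqueP S : reflect {in S &, forall x y, x != y -> G x y} (clique S).
Proof.
apply: (iffP forall_inP) => [cl x y xS yS xy|cl x xS].
  by have /forall_inP/(_ y yS)/implyP/(_ xy) := cl x xS.
by apply/forall_inP => y yS; apply/implyP; apply: cl.
Qed.

Lemma iso_complete_card W (H : sgraph {x : V | x \in W}) k :
  graph_iso H (complete_graph k) -> #|W| = k.
Proof.
by case=> f [f_bij _]; have := bij_eq_card f_bij; rewrite card_sig card_ord.
Qed.

Lemma induced_complete S : clique S -> graph_iso (induced G S) (complete_graph #|S|).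
Proof.
move=> /cliqueP cl; have cS : #|{: {x : V | x \in S}}| = #|S| by rewrite card_sig.
exists (fun x => cast_ord cS (enum_rank x)); split.
  exists (fun i => enum_val (cast_ord (esym cS) i)) => i.
    by rewrite cast_ordK enum_rankK.
  by rewrite enum_valK cast_ordKV.
move=> x y /=; rewrite (inj_eq (@cast_ord_inj _ _ cS)) (inj_eq enum_rank_inj).
have [->|xy] := eqVneq x y; first by rewrite adj_irr.
by rewrite cl ?(valP x) ?(valP y).
Qed.

Lemma complete_setsE t T : (T \in complete_sets G t) = (#|T| == t) && clique T.
Proof.
rewrite inE; apply/asboolP/andP => [iso|[/eqP <-]]; last exact: induced_complete.
split; first by rewrite (iso_complete_card iso).
apply/cliqueP => x y xT yT xy; have [f [f_bij fE]] := iso.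
have := fE (Sub x xT) (Sub y yT); rewrite /= => <-.
by rewrite (inj_eq (bij_inj f_bij)).
Qed.

(** A complete subgraph on [W] already contains every pair of [W], so it coincides with the induced
    one. *)
Lemma in_complete_subgraphP T k :
  in_complete_subgraph G T k <-> exists W, [/\ clique W, #|W| = k & T \subset W].
Proof.
split=> [[W [H [sub iso sTW]]]|[W [cl <- sTW]]]; exists W.
  split=> //; last exact: iso_complete_card iso.
  apply/cliqueP => x y xW yW xy; have [f [f_bij fE]] := iso.
  apply: (sub (Sub x xW) (Sub y yW)); rewrite -fE /=.
  by rewrite (inj_eq (bij_inj f_bij)).
by exists (induced G W); split => //; apply: induced_complete.
Qed.

Lemma leq_alpha T W : clique W -> T \subset W -> (#|W| <= alpha G T)%N.
Proof.
move=> cl sTW; have cW : (#|W| < #|V|.+1)%N by rewrite ltnS max_card.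
apply: (@leq_bigmax_cond _ _ _ (Ordinal cW)).
by apply/asboolP/in_complete_subgraphP; exists W.
Qed.

Lemma alpha_witness T : clique T -> exists W, [/\ clique W, #|W| = alpha G T & T \subset W].
Proof.
move=> cl; apply/in_complete_subgraphP; rewrite /alpha.
have cT : (#|T| < #|V|.+1)%N by rewrite ltnS max_card.
(* [T] itself makes the range of the maximum nonempty, so the maximum is attained. *)
have PT : `[< in_complete_subgraph G T (Ordinal cT) >].
  by apply/asboolP/in_complete_subgraphP; exists T.
have [|i /asboolP Pi ->] // := @eq_bigmax_cond _
  [pred k : 'I_#|V|.+1 | `[< in_complete_subgraph G T k >]] (fun k : 'I_#|V|.+1 => k : nat).
by apply/card_gt0P; exists (Ordinal cT).
Qed.

Lemma mem_complete_sets_leq_alpha t T : T \in complete_sets G t -> (t <= alpha G T)%N.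
Proof. by rewrite complete_setsE => /andP[/eqP<- cl]; apply: leq_alpha. Qed.

(** * Complete multipartite graphs with nonempty parts *)

Section Multipartite.
Variables (r : nat) (c : V -> 'I_r).
Hypothesis Gc : forall x y, G x y = (c x != c y).

Lemma clique_multipartite T : clique T = (#|c @: T| == #|T|).
Proof.
apply/cliqueP/imset_injP => [cl x y xT yT cxy|c_inj x y xT yT xy].
  by apply/eqP/negPn/negP => xy; have := cl x y xT yT xy; rewrite Gc cxy eqxx.
by rewrite Gc; apply: contraNneq xy => /c_inj ->.
Qed.

Hypothesis c_surj : forall i, exists v, c v = i.

Lemma alpha_multipartite T : clique T -> alpha G T = r.
Proof.
move=> clT; apply/eqP; rewrite eqn_leq; apply/andP; split.
  have [W [clW <- _]] := alpha_witness clT.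
  move: clW; rewrite clique_multipartite => /eqP <-.
  by rewrite -[X in (_ <= X)%N](card_ord r) max_card.
have [rep repK] := choice c_surj.
(* [g] extends [T] to a clique meeting all parts: it takes the vertex of [T] in part [i] if there is
   one, else a representative. *)
pose g i := odflt (rep i) [pick v in T | c v == i].
have cg i : c (g i) = i by rewrite /g; case: pickP => [v /andP[_ /eqP]|] //=.
have g_inj : injective g by apply: can_inj cg.
rewrite -[X in (X <= _)%N](card_ord r) -cardsT -(card_imset _ g_inj).
apply: leq_alpha.
  rewrite clique_multipartite; apply/imset_injP => _ _ /imsetP[i _ ->] /imsetP[j _ ->].
  by rewrite !cg => ->.
apply/subsetP=> v vT; apply/imsetP; exists (c v) => //; rewrite /g.
move: clT; rewrite clique_multipartite => /imset_injP c_inj.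
case: pickP => [u /andP[uT /eqP cuv]|/(_ v)]; last by rewrite vT eqxx.
by apply: c_inj.
Qed.

(** All [t]-cliques have the same weight, and the elementary symmetric polynomial of the part sizes
    counts them. *)
Lemma sum_weight_multipartite t (v0 : V) :
  \sum_(T in complete_sets G t) weight G t T =
  weight_of t r * elem_sym [set: 'I_r] t (fun i => #|[set v | c v == i]|%:R).
Proof.
rewrite (eq_bigr (fun=> weight_of t r)) => [|T]; last first.
  by rewrite complete_setsE /weight => /andP[_ /alpha_multipartite->].
have -> : elem_sym [set: 'I_r] t (fun i => #|[set v | c v == i]|%:R) =
    elem_sym [set: 'I_r] t (fun i => \sum_(v | c v == i) 1) :> rat.
  rewrite /elem_sym; apply: eq_bigr => T _; apply: eq_bigr => i _.
  by rewrite sumr_const; congr _%:R; apply: eq_card => v; rewrite !inE.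
rewrite -(elem_sym_fibers v0) mulr_sumr; apply: eq_big => [T|T _].
  by rewrite complete_setsE clique_multipartite.
by rewrite prodr_const expr1n mulr1.
Qed.
End Multipartite.

(** * The weighted clique sum as a multilinear form *)

Definition clique_weight t T : rat :=
  if T \in complete_sets G t then weight G t T else 0.

Lemma weight_of_ge0 t k : 0 <= weight_of t k.
Proof. by rewrite /weight_of divr_ge0 ?exprn_ge0. Qed.

Lemma clique_weight_ge0 t T : 0 <= clique_weight t T.
Proof. by rewrite /clique_weight; case: ifP => // _; apply: weight_of_ge0. Qed.

Lemma clique_weight_eq0 t T : (2 <= t)%N ->
  (clique_weight t T == 0) = (T \notin complete_sets G t).
Proof.
move=> t2; rewrite /clique_weight; case: ifP => [TK|]; last by rewrite eqxx.
have tT := mem_complete_sets_leq_alpha TK.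
rewrite /weight /weight_of; apply/negbTE/lt0r_neq0; rewrite divr_gt0 ?exprn_gt0 //.
  by rewrite ltr0n (leq_trans _ tT) // ltnW.
by rewrite ltr0n bin_gt0.
Qed.

Lemma mform_clique_weight1 t :
  mform (clique_weight t) (fun=> 1) = \sum_(T in complete_sets G t) weight G t T.
Proof.
rewrite /mform [RHS]big_mkcond; apply: eq_bigr => T _.
by rewrite prodr_const expr1n mulr1.
Qed.

Lemma mform_clique_weight_le t (x : V -> rat) : (2 <= t)%N -> (forall z, 0 <= x z) ->
  mform (clique_weight t) x <= (\sum_z x z) ^+ t.
Proof.
move=> t2; apply: (@mform_le _ _ _ (adj G)).
- move=> T u v uT vT uv nG; apply/eqP; rewrite clique_weight_eq0 // complete_setsE.
  by apply: contra nG => /andP[_ /cliqueP]; apply.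
- move=> S T /cliqueP clS sTS; rewrite /clique_weight; case: ifP => [TK|]; last first.
    by rewrite mul0r exprn_ge0.
  have [cT _] : #|T| = t /\ clique T.
    by move: TK; rewrite complete_setsE => /andP[/eqP].
  have tS : (t <= #|S|)%N by rewrite -cT subset_leq_card.
  rewrite -ler_pdivlMr ?ltr0n ?bin_gt0 // -/(weight_of t #|S|) /weight.
  (* The clique [S] around [T] gives [#|S| <= alpha G T], and the weight decreases in [alpha]. *)
  have := leq_alpha clS sTS; rewrite leq_eqVlt => /predU1P[-> //|lt].
  by apply/ltW/weight_of_lt.
move=> T cT; apply/eqP; rewrite clique_weight_eq0 // complete_setsE.
by rewrite (negPf cT).
Qed.
End GraphFacts.

Lemma sum_card_fibers (V I : finType) (c : V -> I) :
  (\sum_(i in [set: I]) #|[set v | c v == i]| = #|V|)%N.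
Proof.
rewrite -sum1_card (partition_big c (mem [set: I])) => [|v _]; last by rewrite inE.
apply: eq_bigr => i _; rewrite sum1_card.
by apply: eq_card => v; rewrite !inE.
Qed.

(** * Structure of the graphs attaining equality *)

Section EqualityCase.
Variables (V : finType) (G : sgraph V) (t : nat) (v0 : V).
Hypothesis t2 : (2 <= t)%N.
Hypothesis sum_eq : \sum_(T in complete_sets G t) weight G t T = #|V|%:R ^+ t.

(** Equality is added for reflexivity: a vertex in a [t]-clique fails the second clause against
    itself. *)
Definition same_part u v :=
  (u == v) || [forall T : {set V} in complete_sets G t, ~~ ((u \in T) && (v \in T))].

Lemma same_partC : symmetric same_part.
Proof.
move=> u v; rewrite /same_part eq_sym; congr (_ || _).
by apply/forall_inP/forall_inP => uv T /uv; rewrite andbC.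
Qed.

Lemma same_part_clique_weight u v : u != v -> same_part u v ->
  forall T : {set V}, u \in T -> v \in T -> clique_weight G t T = 0.
Proof.
rewrite /same_part => /negPf-> /= /forall_inP uv T uT vT.
apply/eqP; rewrite clique_weight_eq0 //.
by apply/negP => /uv; rewrite uT vT.
Qed.

Lemma same_part_trans : transitive same_part.
Proof.
move=> z u v; have [-> //|uz] := eqVneq u z; have [-> //|zv] := eqVneq z v.
have [->|uv] := eqVneq u v; first by rewrite /same_part eqxx.
move=> /(same_part_clique_weight uz) nuz /(same_part_clique_weight zv) nzv.
rewrite /same_part (negPf uv); apply/forall_inP => T TK; apply/negP => /andP[uT vT].
have max1 : mform (clique_weight G t) (fun=> 1) = (\sum_(z : V) 1) ^+ t.
  by rewrite mform_clique_weight1 sum_eq sumr_const.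
have := @maximizer_trans _ _ (clique_weight G t) t (fun=> 1) u z v
  (fun y => @mform_clique_weight_le _ G t y t2) (clique_weight_ge0 G t) (fun=> ltr01)
  max1 uz zv uv nuz nzv T uT vT.
by move/eqP; rewrite clique_weight_eq0 ?TK.
Qed.

(* An edge inside a part, joined to t - 2 vertices of a t-clique outside that
   part, would be a t-clique containing two vertices of the same part. *)
Lemma same_part_adj x y : G x y = ~~ same_part x y.
Proof.
have cross_adj u v : ~~ same_part u v -> G u v.
  rewrite negb_or negb_forall_in => /andP[uNv /exists_inP[T TK]].
  rewrite negbK => /andP[uT vT].
  by move: TK; rewrite complete_setsE => /andP[_ /cliqueP]; apply.
apply/idP/idP => [xy|]; last exact: cross_adj.
have xNy : x != y by apply: contraTneq xy => ->; rewrite adj_irr.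
(* Without a [t]-clique the sum would be 0, whereas [v0] makes [#|V|^t] positive. *)
apply/negP => Exy; have [T0 T0K] : exists T : {set V}, T \in complete_sets G t.
  have [T TK|K0] := pickP (mem (complete_sets G t)); first by exists T.
  have /eqP := sum_eq; rewrite big_pred0 //.
  by rewrite eq_sym expf_eq0 pnatr_eq0 (cardD1 v0) inE andbF.
have sepT0 u v : u \in T0 -> v \in T0 -> same_part u v -> u = v.
  move=> uT vT /orP[/eqP //|/forall_inP/(_ T0 T0K)]; by rewrite uT vT.
have /andP[/eqP cT0 /cliqueP clT0] : (#|T0| == t) && clique G T0.
  by rewrite -complete_setsE.
pose P := [set z | same_part x z].
(* Hence at least [t - 1] vertices of [T0] lie outside the part of [x], enough to choose [t - 2]. *)
have le1 : (#|T0 :&: P| <= 1)%N.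
  apply/card_le1_eqP => u v; rewrite !inE => /andP[uT xu] /andP[vT xv].
  by apply: sepT0 => //; apply: (@same_part_trans x); rewrite // same_partC.
have [|T1 sT1 cT1] := @ex_subset_card _ (T0 :\: P) (t - 2).
  by have := cardsID P T0; lia.
have T1P z : z \in T1 -> z \in T0 /\ ~~ same_part x z.
  by move/(subsetP sT1); rewrite !inE => /andP[].
have sep_adj u z : same_part x u -> z \in T1 -> G u z && G z u.
  move=> xu zT1; have [_ xz] := T1P z zT1.
  have uz : ~~ same_part u z by apply: contra xz; apply: same_part_trans xu.
  by rewrite [G z u]adj_sym andbb cross_adj.
have xx : same_part x x by rewrite /same_part eqxx.
have xT1 : x \notin T1 by apply/negP => /T1P[_]; rewrite xx.
have yT1 : y \notin T1 by apply/negP => /T1P[_]; rewrite Exy.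
have TK : x |: (y |: T1) \in complete_sets G t.
  rewrite complete_setsE !cardsU1 in_setU1 (negPf xNy) (negPf xT1) yT1 cT1.
  apply/andP; split; first by apply/eqP => /=; lia.
  apply/cliqueP => u v; rewrite !in_setU1.
  case/or3P=> [/eqP->|/eqP->|uT]; case/or3P=> [/eqP->|/eqP->|vT] uv //.
  - by rewrite eqxx in uv.
  - by case/andP: (sep_adj x v xx vT).
  - by rewrite adj_sym.
  - by rewrite eqxx in uv.
  - by case/andP: (sep_adj y v Exy vT).
  - by case/andP: (sep_adj x u xx uT).
  - by case/andP: (sep_adj y u Exy uT).
  - by apply: clT0 => //; [case: (T1P u uT)|case: (T1P v vT)].
have xT : x \in x |: (y |: T1) by rewrite !inE eqxx.
have yT : y \in x |: (y |: T1) by rewrite !inE eqxx orbT.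
have /eqP := same_part_clique_weight xNy Exy xT yT.
by rewrite clique_weight_eq0 // TK.
Qed.

(** The parts are the classes of [same_part], and [c] numbers them. *)
Lemma multipartite_of_eq : exists r (c : V -> 'I_r),
  (forall i, exists v, c v = i) /\ (forall x y, G x y = (c x != c y)).
Proof.
pose cl v := [set u | same_part v u].
have cl_eq u v : (cl u == cl v) = same_part u v.
  apply/eqP/idP => [E|uv].
    have : v \in cl v by rewrite inE /same_part eqxx.
    by rewrite -E inE.
  apply/setP=> z; rewrite !inE; apply/idP/idP; last exact: same_part_trans.
  by apply: same_part_trans; rewrite same_partC.
have cl_in v : cl v \in cl @: [set: V] by apply: imset_f; rewrite inE.
exists #|cl @: [set: V]|, (fun v => enum_rank_in (cl_in v0) (cl v)); split=> [i|x y].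
  have /imsetP[v _ E] := enum_valP i.
  by exists v; rewrite -E enum_valK_in.
rewrite same_part_adj -cl_eq; congr (~~ _); apply/eqP/eqP => [-> //|].
exact: (enum_rank_in_inj (cl_in x) (cl_in y)).
Qed.

Lemma balanced_of_eq : exists r, (t <= r)%N /\ balanced_multipartite G r.
Proof.
have [r [c [c_surj Gc]]] := multipartite_of_eq.
have n_gt0 : 0 < #|V|%:R :> rat by rewrite ltr0n; apply/card_gt0P; exists v0.
have [tr|rt] := leqP t r; last first.
  (* Here ['C(r, t) = 0], so by the convention [1/0 = 0] the sum vanishes, contradicting
     [#|V|^t > 0]. *)
  have := sum_eq; rewrite (sum_weight_multipartite Gc c_surj t v0) /weight_of.
  by rewrite bin_small // invr0 mulr0 mul0r => E; move: (exprn_gt0 t n_gt0); rewrite -E ltxx.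
exists r; split=> //; exists c; split=> //.
pose y i : rat := #|[set v | c v == i]|%:R.
have sy : \sum_(i in [set: 'I_r]) y i = #|V|%:R by rewrite -natr_sum sum_card_fibers.
have y_gt0 i : 0 < y i.
  by rewrite ltr0n; apply/card_gt0P; have [v cv] := c_surj i; exists v; rewrite inE cv.
have r0 : r%:R != 0 :> rat by rewrite pnatr_eq0; lia.
suff mean i : y i * r%:R = #|V|%:R.
  by move=> i j; apply/eqP; rewrite -(eqr_nat rat); apply/eqP/(mulIf r0); rewrite !mean.
(* A part off the mean size would make Maclaurin's inequality strict, while [sum_eq] states its
   equality. *)
apply/eqP/negPn/negP => yi.
have := @maclaurin_lt _ _ [set: 'I_r] t y i (fun i => ltW (y_gt0 i)).
rewrite cardsT card_ord t2 tr inE sy => /(_ isT (fun i _ => y_gt0 i) isT yi).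
rewrite -sum_eq (sum_weight_multipartite Gc c_surj t v0) -/y /weight_of mulrA mulrCA.
by rewrite divff ?mulr1 1?mulrC ?ltxx // pnatr_eq0 -lt0n bin_gt0.
Qed.
End EqualityCase.

(** * Equality for balanced graphs, and the full statement *)

(** With [r] parts of size [m] there are ['C(r, t) m^t] cliques, each of weight [r^t / 'C(r, t)],
    and [r m = #|V|]. *)
Lemma sum_weight_balanced (V : finType) (G : sgraph V) t r :
  (2 <= t)%N -> (t <= r)%N -> balanced_multipartite G r ->
  \sum_(T in complete_sets G t) weight G t T = #|V|%:R ^+ t.
Proof.
move=> t2 tr [c [Gc bal]].
(* On the empty vertex type the parts are empty; both sides are then 0 because [t] is positive. *)
have [v0 _|V0] := pickP (@predT V); last first.
  have nV : #|V| = 0%N by apply: eq_card0 => v; have := V0 v.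
  rewrite nV expr0n big_pred0 => [|T]; first by case: t t2 {tr}.
  rewrite complete_setsE; apply/negbTE/negP => /andP[/eqP cT _].
  by move: (max_card (mem T)) t2; rewrite nV cT; case: t {tr cT}.
have c_surj i : exists v, c v = i.
  have /card_gt0P[v] : (0 < #|[set v | c v == i]|)%N.
    by rewrite (bal i (c v0)); apply/card_gt0P; exists v0; rewrite inE.
  by rewrite inE => /eqP; exists v.
rewrite (sum_weight_multipartite Gc c_surj t v0).
set m : rat := #|[set v | c v == c v0]|%:R.
rewrite (@elem_sym_const _ _ _ _ m) => [|i _]; last by rewrite (bal i (c v0)).
rewrite cardsT card_ord /weight_of mulrA divfK ?pnatr_eq0 -?lt0n ?bin_gt0 //.
rewrite -exprMn; congr (_ ^+ _); rewrite -(sum_card_fibers c).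
rewrite (eq_bigr (fun=> #|[set v | c v == c v0]|)) => [|i _]; last exact: bal.
by rewrite sum_nat_const natrM cardsT card_ord.
Qed.

Local Close Scope ring_scope.

Theorem theorem3p1 (t n : nat) (V : finType) (G : sgraph V)
    (ht : 2 <= t) (hn : #|V| = n) :
  (forall T : {set V}, T \in complete_sets G t ->
     [/\ in_complete_subgraph G T (alpha G T),
         (forall k : nat, in_complete_subgraph G T k -> k <= alpha G T)
       & 'C(alpha G T, t) != 0]) /\
  (forall k l : nat, t <= k -> k < l -> (weight_of t l < weight_of t k)%R) /\
  (\sum_(T in complete_sets G t) weight G t T <= n%:R ^+ t)%R /\
  ((\sum_(T in complete_sets G t) weight G t T = n%:R ^+ t)%R <->
   exists r : nat, t <= r /\ balanced_multipartite G r).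
Proof.
rewrite -hn; split=> [T TK|].
  have /andP[_ clT] : (#|T| == t) && clique G T by rewrite -complete_setsE.
  split; first exact/in_complete_subgraphP/alpha_witness.
    by move=> k /in_complete_subgraphP[W [clW <- sTW]]; apply: leq_alpha.
  by rewrite -lt0n bin_gt0 mem_complete_sets_leq_alpha.
split; first by move=> k l; apply: weight_of_lt.
split.
  rewrite -mform_clique_weight1; apply: le_trans (mform_clique_weight_le G ht _) _ => //.
  by rewrite sumr_const.
split=> [sum_eq|[r [tr bal]]]; last exact: sum_weight_balanced bal.
(* On the empty vertex type, [t] empty parts serve as witness. *)
have [v0 _|V0] := pickP (@predT V); first exact: balanced_of_eq v0 ht sum_eq.
have noV (v : V) : False by have := V0 v.
exists t; split=> //; exists (fun v => False_rect _ (noV v)); split=> [x|i j].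
  by case: (noV x).
by rewrite !eq_card0 // => v; case: (noV v).
Qed.
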